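(* Consider the single stage pricing game with additive loyalty described in the context, with parameters $c_A\ge c_B\ge 0$, $s_\alpha,s_\beta\ge0$, $\theta\in(0,1)$, and $F$ the distribution function of the uniform distribution on $[0,1]$. Suppose (Region V) $$s_\alpha-1\le c_A-c_B\le\min(s_\alpha+2,\;1-s_\beta) .$$ Then the game has a unique pure Nash equilibrium, and its prices are $$p_A^\alpha=\tfrac13(2c_A+c_B+s_\alpha+2),\quad p_A^\beta=\tfrac13(c_B+2c_A-s_\beta+1),$$ $$p_B^\beta=\tfrac13(2c_B+c_A+s_\beta+2),\quad p_B^\alpha=\tfrac13(c_A+2c_B-s_\alpha+1) .$$
   Context: Two firms $A$ and $B$ sell the same product, with unit product costs $c_A$ and $c_B$, where $c_A\ge c_B\ge 0$. Customers are partitioned into a set $\alpha$ (ex ante loyal to $A$; a fraction $\theta$ of the market) and a set $\beta$ (ex ante loyal to $B$; a fraction $1-\theta$). Both firms can tell the two sets apart. Each customer buys exactly one unit, from $A$ or from $B$. Firms move simultaneously: $A$ chooses $(p_A^\alpha,p_A^\beta)$ with $p_A^\alpha,p_A^\beta\ge c_A$, and $B$ chooses $(p_B^\beta,p_B^\alpha)$ with $p_B^\beta,p_B^\alpha\ge c_B$; the superscript is the set of customers to which the price is offered. Additive loyalty: a customer in $\alpha$ has loyalty level $\xi+s_\alpha$ and buys from $A$ iff $\xi+s_\alpha\ge p_A^\alpha-p_B^\alpha$; a customer in $\beta$ has loyalty level $\xi+s_\beta$ and buys from $B$ iff $\xi+s_\beta\ge p_B^\beta-p_A^\beta$; here $\xi$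 is random with distribution function $F$. Put $\xi^\alpha=p_A^\alpha-p_B^\alpha-s_\alpha$ and $\xi^\beta=p_B^\beta-p_A^\beta-s_\beta$. For the uniform distribution, $F(x)=0$ for $x\le 0$, $F(x)=x$ for $0\le x\le1$, $F(x)=1$ for $x\ge1$. Profits: firm $A$ gets $(p_A^\alpha-c_A)\,\theta\,(1-F(\xi^\alpha))+(p_A^\beta-c_A)(1-\theta)F(\xi^\beta)$; firm $B$ gets $(p_B^\beta-c_B)(1-\theta)(1-F(\xi^\beta))+(p_B^\alpha-c_B)\,\theta\,F(\xi^\alpha)$. A pure Nash equilibrium is a price profile $(p_A^\alpha,p_A^\beta,p_B^\beta,p_B^\alpha)$ from which neither firm can strictly increase its profit by unilaterally changing its own (feasible) prices. *)

(* Defs.v *)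
From Stdlib Require Import Reals.
Open Scope R_scope.

(** Single stage duopoly pricing game with additive loyalty, over Stdlib's
    real numbers. *)

Record game := Game {
  cA : R;          (* unit cost of firm A *)
  cB : R;          (* unit cost of firm B *)
  s_alpha : R;     (* loyalty shift of the customers ex ante loyal to A *)
  s_beta : R;      (* loyalty shift of the customers ex ante loyal to B *)
  theta : R;       (* market fraction of the set alpha *)
  F : R -> R       (* distribution function of the random loyalty term *)
}.

(** The superscript of a price is the set of customers to which it is offered. *)
Record strategyA := StrategyA { pA_alpha : R; pA_beta : R }.
Record strategyB := StrategyB { pB_beta : R; pB_alpha : R }.

Definition profile : Type := (strategyA * strategyB)%type.

Definition feasibleA (G : game) (a : strategyA) : Prop :=
  cA G <= pA_alpha a /\ cA G <= pA_beta a.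

Definition feasibleB (G : game) (b : strategyB) : Prop :=
  cB G <= pB_beta b /\ cB G <= pB_alpha b.

(** A customer of alpha with loyalty xi + s_alpha buys from A iff
    xi >= xi_alpha, and one of beta with loyalty xi + s_beta buys from B iff
    xi >= xi_beta. *)
Definition xi_alpha (G : game) (a : strategyA) (b : strategyB) : R :=
  pA_alpha a - pB_alpha b - s_alpha G.

Definition xi_beta (G : game) (a : strategyA) (b : strategyB) : R :=
  pB_beta b - pA_beta a - s_beta G.

Definition profitA (G : game) (a : strategyA) (b : strategyB) : R :=
  (pA_alpha a - cA G) * theta G * (1 - F G (xi_alpha G a b))
  + (pA_beta a - cA G) * (1 - theta G) * F G (xi_beta G a b).

Definition profitB (G : game) (a : strategyA) (b : strategyB) : R :=
  (pB_beta b - cB G) * (1 - theta G) * (1 - F G (xi_beta G a b))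
  + (pB_alpha b - cB G) * theta G * F G (xi_alpha G a b).

Definition pure_nash (G : game) (p : profile) : Prop :=
  let (a, b) := p in
  feasibleA G a /\ feasibleB G b /\
  (forall a' : strategyA, feasibleA G a' -> profitA G a' b <= profitA G a b) /\
  (forall b' : strategyB, feasibleB G b' -> profitB G a b' <= profitB G a b).

(** Distribution function of the uniform distribution on [0, 1]. *)
Definition F_uniform (x : R) : R :=
  if Rle_dec x 0 then 0 else if Rle_dec x 1 then x else 1.

(* Main.v *)
Require Import Defs.
From Stdlib Require Import Reals Lra Psatz.
Open Scope R_scope.

(** The profits are additively separable over the sets alpha and beta, so a pure
    Nash equilibrium of the game is a pair of equilibria of two independent
    one-market games.  In a market, let [x] and [y] be the markups of the favoured
    firm and of its rival, and [t] the loyalty shift of the market corrected by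
    the cost difference; the favoured firm earns [x * (1 - F (x - y - t))].  Since
    [1 - F z = F (1 - z)], the rival faces the same problem with [x] and [y]
    exchanged and [t] replaced by [-1 - t].  First order conditions give
    [x = 1 - z] and [y = z] for [z = x - y - t], and the one-sided conditions
    at the kinks [z = 0], [z = 1] leave no further equilibrium when
    [-2 <= t <= 1]. *)

Lemma F_uniform_le0 z : z <= 0 -> F_uniform z = 0.
Proof.
intros Hz; unfold F_uniform.
destruct (Rle_dec z 0); [reflexivity | lra].
Qed.

Lemma F_uniform_mid z : 0 <= z <= 1 -> F_uniform z = z.
Proof.
intros Hz; unfold F_uniform.
destruct (Rle_dec z 0); [lra |].
destruct (Rle_dec z 1); lra.
Qed.

Lemma F_uniform_ge1 z : 1 <= z -> F_uniform z = 1.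
Proof.
intros Hz; unfold F_uniform.
destruct (Rle_dec z 0); [lra |].
destruct (Rle_dec z 1); lra.
Qed.

Lemma F_uniform_sym z : F_uniform (1 - z) = 1 - F_uniform z.
Proof.
destruct (Rle_dec z 0).
- rewrite (F_uniform_le0 z), F_uniform_ge1; lra.
- destruct (Rle_dec z 1).
  + rewrite !F_uniform_mid; lra.
  + rewrite (F_uniform_ge1 z), F_uniform_le0; lra.
Qed.

Definition revenue (t x y : R) : R := x * (1 - F_uniform (x - y - t)).

Definition best_reply (t x y : R) : Prop :=
  0 <= x /\ forall x', 0 <= x' -> revenue t x' y <= revenue t x y.

Definition market_nash (t x y : R) : Prop :=
  best_reply t x y /\ best_reply (-1 - t) y x.

(** At a negative threshold every customer is already kept, and a raise to [y + t] loses none. *)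
Lemma best_reply_ge0 t x y : best_reply t x y -> 0 <= x - y - t.
Proof.
intros [Hx Hbr].
destruct (Rle_lt_dec 0 (x - y - t)) as [| Hz]; [assumption | exfalso].
specialize (Hbr (y + t) ltac:(lra)); unfold revenue in Hbr.
rewrite !F_uniform_le0 in Hbr; lra.
Qed.

(** The right derivative of revenue at [z = x - y - t] in [[0, 1)] is [1 - z - x]; if it were
    positive, a small raise would pay. *)
Lemma best_reply_lower t x y :
  best_reply t x y -> x - y - t < 1 -> 1 - (x - y - t) <= x.
Proof.
intros Hb Hz1; pose proof (best_reply_ge0 _ _ _ Hb) as Hz0.
destruct Hb as [Hx Hbr].
destruct (Rle_lt_dec (1 - (x - y - t)) x) as [| Hlt]; [assumption | exfalso].
(* A raise by [e] gains [e * (1 - z - x - e)]; half the gap makes this [e * e]. *)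
set (e := (1 - (x - y - t) - x) / 2).
assert (He : 2 * e = 1 - (x - y - t) - x) by (unfold e; lra).
specialize (Hbr (x + e) ltac:(lra)); unfold revenue in Hbr.
rewrite !F_uniform_mid in Hbr by lra.
nra.
Qed.

Lemma best_reply_upper t x y :
  best_reply t x y -> 0 < x - y - t <= 1 -> x <= 1 - (x - y - t).
Proof.
intros [Hx Hbr] Hz.
destruct (Rle_lt_dec x (1 - (x - y - t))) as [| Hlt]; [assumption | exfalso].
set (d := (x - (1 - (x - y - t))) / 2).
assert (Hd : 2 * d = x - (1 - (x - y - t))) by (unfold d; lra).
(* A cut by [e] gains [e * (2 * d - e)], positive for [0 < e <= d]; the cap at [z] keeps the new
   threshold nonnegative, on the linear piece. *)
set (e := Rmin (x - y - t) d).
assert (He1 : e <= x - y - t) by apply Rmin_l.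
assert (He2 : e <= d) by apply Rmin_r.
assert (He0 : 0 < e) by (apply Rmin_glb_lt; lra).
specialize (Hbr (x - e) ltac:(lra)); unfold revenue in Hbr.
rewrite !F_uniform_mid in Hbr by lra.
nra.
Qed.

(** The equation is the first order condition [x = 1 - z], so revenue is [x ^ 2]. A deviation [x']
    earns [x ^ 2 - (x' - x) ^ 2] on the linear piece, [x' <= 2 * x - 1 <= x ^ 2] below it, and 0
    above. *)
Lemma best_reply_interior t x y :
  0 <= x <= 1 -> y + t = 2 * x - 1 -> best_reply t x y.
Proof.
intros Hx Hyt; split; [lra |].
intros x' Hx'; unfold revenue.
replace y with (2 * x - 1 - t) in * by lra.
pose proof (pow2_ge_0 (x' - x)).
pose proof (pow2_ge_0 (1 - x)).
rewrite (F_uniform_mid (x - (2 * x - 1 - t) - t)) by lra.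
destruct (Rle_dec (x' - (2 * x - 1 - t) - t) 0).
- rewrite F_uniform_le0 by lra; nra.
- destruct (Rle_dec (x' - (2 * x - 1 - t) - t) 1).
  + rewrite F_uniform_mid by lra; nra.
  + rewrite F_uniform_ge1 by lra; nra.
Qed.

Lemma market_nash_iff t x y : -2 <= t <= 1 ->
  market_nash t x y <-> x = (t + 2) / 3 /\ y = (1 - t) / 3.
Proof.
intros Ht; split.
- intros [HA HB].
  pose proof (best_reply_ge0 _ _ _ HA).
  pose proof (best_reply_ge0 _ _ _ HB).
  pose proof (best_reply_lower _ _ _ HA).
  pose proof (best_reply_lower _ _ _ HB).
  pose proof (best_reply_upper _ _ _ HA).
  pose proof (best_reply_upper _ _ _ HB).
  destruct HA as [Hx _], HB as [Hy _].
  (* The rival's threshold is [1 - z], so [0 <= z <= 1]. The kink [z = 0] forces [y = 0] and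
     [x = t = 1]; [z = 1] forces [x = 0], [y = 1], [t = -2]. Both agree with the interior
     solution. *)
  destruct (Rlt_dec 0 (x - y - t)), (Rlt_dec (x - y - t) 1); lra.
- intros [-> ->]; split; apply best_reply_interior; lra.
Qed.

Section Decoupling.

Variables c_A c_B sa sb th : R.
Hypothesis hth : 0 < th < 1.

Let G := Game c_A c_B sa sb th F_uniform.
Let t_alpha := sa - (c_A - c_B).
Let t_beta := sb + (c_A - c_B).

Lemma profitA_split a b :
  profitA G a b =
  th * revenue t_alpha (pA_alpha a - c_A) (pB_alpha b - c_B)
  + (1 - th) * revenue (-1 - t_beta) (pA_beta a - c_A) (pB_beta b - c_B).
Proof.
unfold profitA, revenue, xi_alpha, xi_beta, t_alpha, t_beta; simpl.
replace (pA_beta a - c_A - (pB_beta b - c_B) - (-1 - (sb + (c_A - c_B))))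
  with (1 - (pB_beta b - pA_beta a - sb)) by ring.
rewrite F_uniform_sym.
replace (pA_alpha a - c_A - (pB_alpha b - c_B) - (sa - (c_A - c_B)))
  with (pA_alpha a - pB_alpha b - sa) by ring.
ring.
Qed.

Lemma profitB_split a b :
  profitB G a b =
  (1 - th) * revenue t_beta (pB_beta b - c_B) (pA_beta a - c_A)
  + th * revenue (-1 - t_alpha) (pB_alpha b - c_B) (pA_alpha a - c_A).
Proof.
unfold profitB, revenue, xi_alpha, xi_beta, t_alpha, t_beta; simpl.
replace (pB_alpha b - c_B - (pA_alpha a - c_A) - (-1 - (sa - (c_A - c_B))))
  with (1 - (pA_alpha a - pB_alpha b - sa)) by ring.
rewrite F_uniform_sym.
replace (pB_beta b - c_B - (pA_beta a - c_A) - (sb + (c_A - c_B)))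
  with (pB_beta b - pA_beta a - sb) by ring.
ring.
Qed.

(** A deviation in one market leaves the other term of the profit fixed, and the positive weights
    [th] and [1 - th] cancel; conversely, optimality in each market adds up. *)
Lemma pure_nash_iff_markets a b :
  pure_nash G (a, b) <->
  market_nash t_alpha (pA_alpha a - c_A) (pB_alpha b - c_B) /\
  market_nash t_beta (pB_beta b - c_B) (pA_beta a - c_A).
Proof.
unfold pure_nash, feasibleA, feasibleB; simpl; split.
- intros [[HAa HAb] [[HBb HBa] [HA HB]]].
  split; split; (split; [lra |]); intros p Hp.
  + specialize (HA (StrategyA (p + c_A) (pA_beta a)) ltac:(simpl; lra)).
    rewrite !profitA_split in HA; simpl in HA.
    replace (p + c_A - c_A) with p in HA by ring; nra.
  + specialize (HB (StrategyB (pB_beta b) (p + c_B)) ltac:(simpl; lra)).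
    rewrite !profitB_split in HB; simpl in HB.
    replace (p + c_B - c_B) with p in HB by ring; nra.
  + specialize (HB (StrategyB (p + c_B) (pB_alpha b)) ltac:(simpl; lra)).
    rewrite !profitB_split in HB; simpl in HB.
    replace (p + c_B - c_B) with p in HB by ring; nra.
  + specialize (HA (StrategyA (pA_alpha a) (p + c_A)) ltac:(simpl; lra)).
    rewrite !profitA_split in HA; simpl in HA.
    replace (p + c_A - c_A) with p in HA by ring; nra.
- intros [[[HAa HA1] [HBa HB1]] [[HBb HB2] [HAb HA2]]].
  split; [lra | split; [lra | split]].
  + intros a' Ha'; rewrite !profitA_split.
    apply Rplus_le_compat; apply Rmult_le_compat_l; try lra;
      [apply HA1 | apply HA2]; lra.
  + intros b' Hb'; rewrite !profitB_split.
    apply Rplus_le_compat; apply Rmult_le_compat_l; try lra;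
      [apply HB2 | apply HB1]; lra.
Qed.

End Decoupling.

Theorem proposition19 (c_A c_B sa sb th : R)
    (hcB : 0 <= c_B) (hcA : c_B <= c_A)
    (hsa : 0 <= sa) (hsb : 0 <= sb)
    (hth0 : 0 < th) (hth1 : th < 1)
    (hV1 : sa - 1 <= c_A - c_B)
    (hV2 : c_A - c_B <= Rmin (sa + 2) (1 - sb)) :
  exists (a : strategyA) (b : strategyB),
    unique (pure_nash (Game c_A c_B sa sb th F_uniform)) (a, b) /\
    pA_alpha a = 1 / 3 * (2 * c_A + c_B + sa + 2) /\
    pA_beta a = 1 / 3 * (c_B + 2 * c_A - sb + 1) /\
    pB_beta b = 1 / 3 * (2 * c_B + c_A + sb + 2) /\
    pB_alpha b = 1 / 3 * (c_A + 2 * c_B - sa + 1).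
Proof.
pose proof (Rmin_l (sa + 2) (1 - sb)).
pose proof (Rmin_r (sa + 2) (1 - sb)).
exists (StrategyA (1 / 3 * (2 * c_A + c_B + sa + 2))
                  (1 / 3 * (c_B + 2 * c_A - sb + 1))).
exists (StrategyB (1 / 3 * (2 * c_B + c_A + sb + 2))
                  (1 / 3 * (c_A + 2 * c_B - sa + 1))).
split; [split | simpl; auto].
- apply pure_nash_iff_markets; [lra |].
  (* Region V says [-2 <= t_alpha <= 1] and [t_beta <= 1]; [t_beta >= 0] follows from [hsb] and
     [hcA]. *)
  rewrite !market_nash_iff by lra; simpl; lra.
- intros [[paa pab] [pbb pba]] Hn.
  apply pure_nash_iff_markets in Hn; [| lra].
  rewrite !market_nash_iff in Hn by lra; simpl in Hn.
  f_equal; f_equal; lra.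
Qed.
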